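(* Let $G$ be a finite group with $32 < |G| < 64$. Then $G$ is not a pure braid quotient; that is, there do not exist integers $b \geq 2$, $n \geq 2$ and a surjective group homomorphism $\varphi \colon \mathsf{P}_2(\Sigma_b) \to G$ such that $\varphi(A_{12})$ has order $n$.
   Context: Let $\Sigma_b$ be a closed Riemann surface of genus $b \geq 2$ and let $\mathscr{P}=(p_1,p_2)$ be an ordered pair of distinct points of $\Sigma_b$. The pure braid group on two strands $\mathsf{P}_2(\Sigma_b)$ is the group of homotopy classes (through braids) of pairs $(\alpha_1,\alpha_2)$ of paths $\alpha_i\colon[0,1]\to\Sigma_b$ with $\alpha_i(0)=\alpha_i(1)=p_i$ and $\alpha_1(t)\neq\alpha_2(t)$ for all $t$, with concatenation as operation. Equivalently, $\mathsf{P}_2(\Sigma_b)\simeq\pi_1(\Sigma_b\times\Sigma_b-\Delta,\mathscr{P})$, where $\Delta\subset\Sigma_b\times\Sigma_b$ is the diagonal. The element $A_{12}\in\mathsf{P}_2(\Sigma_b)$ corresponds to the homotopy class in $\Sigma_b\times\Sigma_b-\Delta$ of a loop in $\Sigma_b\times\Sigma_b$ that winds once around $\Delta$. Explicitly, with the convention $[x,y]=xyx^{-1}y^{-1}$, the group $\mathsf{P}_2(\Sigma_b)$ has the following known presentation (Gonçalves–Guaschi), in which $A_{12}$ is one of the generators. Generators: $\rho_{1j},\ \tau_{1j},\ \rho_{2j},\ \tau_{2j}$ for $j=1,\dots,b$, and $A_{12}$. Surface relations: $$[\rho_{1b}^{-1},\tau_{1b}^{-1}]\,\tau_{1b}^{-1}\,[\rho_{1\,b-1}^{-1},\tau_{1\,b-1}^{-1}]\,\tau_{1\,b-1}^{-1}\cdots[\rho_{11}^{-1},\tau_{11}^{-1}]\,\tau_{11}^{-1}\,(\tau_{11}\tau_{12}\cdots\tau_{1b})=A_{12},$$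 $$[\rho_{21}^{-1},\tau_{21}]\,\tau_{21}\,[\rho_{22}^{-1},\tau_{22}]\,\tau_{22}\cdots[\rho_{2b}^{-1},\tau_{2b}]\,\tau_{2b}\,(\tau_{2b}^{-1}\tau_{2\,b-1}^{-1}\cdots\tau_{21}^{-1})=A_{12}^{-1}.$$ Action of $\rho_{1j}$ (for all $j,k\in\{1,\dots,b\}$ as indicated): - $[\rho_{1j},\rho_{2k}]=1$ if $j<k$; $[\rho_{1j},\rho_{2j}]=1$; $[\rho_{1j},\rho_{2k}]=A_{12}^{-1}\rho_{2k}\rho_{2j}^{-1}A_{12}\rho_{2j}\rho_{2k}^{-1}$ if $j>k$; - $[\rho_{1j},\tau_{2k}]=1$ if $j<k$; $[\rho_{1j},\tau_{2j}]=A_{12}^{-1}$; $[\rho_{1j},\tau_{2k}]=[A_{12}^{-1},\tau_{2k}]$ if $j>k$; - $[\rho_{1j},A_{12}]=[\rho_{2j}^{-1},A_{12}]$. Action of $\tau_{1j}$: - $[\tau_{1j},\rho_{2k}]=1$ if $j<k$; $[\tau_{1j},\rho_{2j}]=\tau_{2j}^{-1}A_{12}\tau_{2j}$; $[\tau_{1j},\rho_{2k}]=[\tau_{2j}^{-1},A_{12}]$ if $j>k$; - $[\tau_{1j},\tau_{2k}]=1$ if $j<k$; $[\tau_{1j},\tau_{2j}]=[\tau_{2j}^{-1},A_{12}]$; $[\tau_{1j},\tau_{2k}]=\tau_{2j}^{-1}A_{12}\tau_{2j}A_{12}^{-1}\tau_{2k}A_{12}\tau_{2j}^{-1}A_{12}^{-1}\tau_{2j}\tau_{2k}^{-1}$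 if $j>k$; - $[\tau_{1j},A_{12}]=[\tau_{2j}^{-1},A_{12}]$. Definition. For integers $b,n\geq 2$, a finite group $G$ is a pure braid quotient of type $(b,n)$ if there exists a surjective group homomorphism $\varphi\colon\mathsf{P}_2(\Sigma_b)\to G$ such that $\varphi(A_{12})$ has order $n$. A finite group is a pure braid quotient if it is a pure braid quotient of type $(b,n)$ for some $b,n\geq 2$. *)

(* Defs.v *)
From HB Require Import structures.
From mathcomp Require Import all_boot all_fingroup.
From mathcomp Require Import boolp.

Set Implicit Arguments.
Unset Strict Implicit.
Unset Printing Implicit Defensive.

Local Open Scope group_scope.
Local Open Scope quotient_scope.

(* A letter (x, false) stands for the generator x and (x, true) for its formal
   inverse. Words are not reduced: u * u^-1 = 1 only holds in the quotient. *)
Definition word (X : choiceType) : Type := seq (X * bool).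

Section Words.
Variable X : choiceType.

HB.instance Definition _ := Choice.on (word X).

Definition word_inv (u : word X) : word X :=
  rev [seq (x.1, ~~ x.2) | x <- u].

Fact word_invK : involutive word_inv.
Proof.
move=> u; rewrite /word_inv map_rev revK -map_comp -[RHS]map_id.
by apply: eq_map => -[x e] /=; rewrite negbK.
Qed.

Fact word_invM : {morph word_inv : u v / u ++ v >-> v ++ u}.
Proof. by move=> u v; rewrite /word_inv map_cat rev_cat. Qed.

HB.instance Definition _ :=
  isStarMonoid.Build (word X) (@catA _) (@cat0s _) word_invK word_invM.

Definition letter (x : X) : word X := [:: (x, false)].

End Words.

Section Presentation.
Variables (X : choiceType) (R : word X -> word X -> Prop).

(* The least group congruence on words containing R; compatibility with
   inverses follows from the clauses below. *)
Inductive pres_cong : word X -> word X -> Prop :=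
| pres_rel u v : R u v -> pres_cong u v
| pres_mulVg u : pres_cong (u^-1 * u) 1
| pres_refl u : pres_cong u u
| pres_sym u v : pres_cong u v -> pres_cong v u
| pres_trans u v w : pres_cong u v -> pres_cong v w -> pres_cong u w
| pres_mul u u' v v' :
    pres_cong u u' -> pres_cong v v' -> pres_cong (u * v) (u' * v').

Lemma pres_inv u v : pres_cong u v -> pres_cong u^-1 v^-1.
Proof.
move=> uv; apply: (@pres_trans _ (u^-1 * (v * v^-1))).
  apply: pres_sym; rewrite -[X in pres_cong _ X]mulg1.
  apply: pres_mul (pres_refl _) _.
  by have := pres_mulVg v^-1; rewrite invgK.
rewrite mulgA -[X in pres_cong _ X]mul1g; apply: pres_mul (pres_refl _).
apply: pres_trans (pres_mulVg u).
by apply: pres_mul (pres_refl _) (pres_sym uv).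
Qed.

Definition pres_equiv : rel (word X) := fun u v => `[< pres_cong u v >].

Fact pres_equiv_refl : reflexive pres_equiv.
Proof. by move=> u; apply/asboolP/pres_refl. Qed.

Fact pres_equiv_sym : symmetric pres_equiv.
Proof. by move=> u v; apply/asboolP/asboolP => /pres_sym. Qed.

Fact pres_equiv_trans : transitive pres_equiv.
Proof.
by move=> v u w /asboolP uv /asboolP vw; apply/asboolP/(pres_trans uv vw).
Qed.

Canonical pres_equiv_rel :=
  EquivRel pres_equiv pres_equiv_refl pres_equiv_sym pres_equiv_trans.

Definition presented : Type := {eq_quot pres_equiv}.

HB.instance Definition _ := Choice.on presented.
HB.instance Definition _ := EqQuotient.on presented.

Definition pres_class (u : word X) : presented := \pi_presented u.

Let pres_repr (x : presented) : word X := generic_quotient.repr x.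

Lemma pres_classP (u v : word X) :
  pres_class u = pres_class v <-> pres_cong u v.
Proof. by split=> [/eqmodP/asboolP|uv]; last by apply/eqmodP/asboolP. Qed.

Lemma pres_classW (P : presented -> Prop) :
  (forall u, P (pres_class u)) -> forall x, P x.
Proof. by move=> Pclass; elim/quotW. Qed.

Let cong_repr (u : word X) : pres_cong (pres_repr (pres_class u)) u.
Proof. by apply/pres_classP; apply: reprK. Qed.

Definition presented_one : presented := pres_class 1.
Definition presented_inv (x : presented) : presented :=
  pres_class (pres_repr x)^-1.
Definition presented_mul (x y : presented) : presented :=
  pres_class (pres_repr x * pres_repr y).

Let class_inv (u : word X) : presented_inv (pres_class u) = pres_class u^-1.
Proof. exact/pres_classP/pres_inv/cong_repr. Qed.

Let class_mul (u v : word X) :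
  presented_mul (pres_class u) (pres_class v) = pres_class (u * v).
Proof. by apply/pres_classP/pres_mul; apply: cong_repr. Qed.

Fact presented_mulA : associative presented_mul.
Proof.
elim/pres_classW=> u; elim/pres_classW=> v; elim/pres_classW=> w.
by rewrite (class_mul v w) (class_mul u v) !class_mul mulgA.
Qed.

Fact presented_mul1g : left_id presented_one presented_mul.
Proof. by elim/pres_classW=> u; rewrite class_mul mul1g. Qed.

Fact presented_mulg1 : right_id presented_one presented_mul.
Proof. by elim/pres_classW=> u; rewrite class_mul mulg1. Qed.

Fact presented_mulVg : left_inverse presented_one presented_inv presented_mul.
Proof.
elim/pres_classW=> u; rewrite class_inv class_mul.
exact/pres_classP/pres_mulVg.
Qed.

Fact presented_mulgV : right_inverse presented_one presented_inv presented_mul.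
Proof.
elim/pres_classW=> u; rewrite class_inv class_mul; apply/pres_classP.
by have := pres_mulVg u^-1; rewrite invgK.
Qed.

HB.instance Definition _ := isGroup.Build presented presented_mulA
  presented_mul1g presented_mulg1 presented_mulVg presented_mulgV.

Lemma pres_classM : {morph pres_class : u v / u * v}.
Proof. by move=> u v; apply/esym/class_mul. Qed.

Lemma pres_classV : {morph pres_class : u / u^-1}.
Proof. by move=> u; apply/esym/class_inv. Qed.

End Presentation.

(* The genus is b, and the index j = 1, ..., b of a generator is encoded by
   the ordinal of value j - 1. *)
Inductive braid_gen (b : nat) : Type :=
| Rho1 of 'I_b | Tau1 of 'I_b | Rho2 of 'I_b | Tau2 of 'I_b | A12.
Arguments A12 {b}.

Section BraidGenChoice.
Variable b : nat.

Definition braid_gen_code (x : braid_gen b) : option (bool * bool * 'I_b) :=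
  match x with
  | Rho1 j => Some (false, false, j)
  | Tau1 j => Some (false, true, j)
  | Rho2 j => Some (true, false, j)
  | Tau2 j => Some (true, true, j)
  | A12 => None
  end.

Definition braid_gen_decode (c : option (bool * bool * 'I_b)) : braid_gen b :=
  match c with
  | Some (false, false, j) => Rho1 j
  | Some (false, true, j) => Tau1 j
  | Some (true, false, j) => Rho2 j
  | Some (true, true, j) => Tau2 j
  | None => A12
  end.

Fact braid_gen_codeK : cancel braid_gen_code braid_gen_decode.
Proof. by case. Qed.

HB.instance Definition _ :=
  Countable.copy (braid_gen b) (can_type braid_gen_codeK).

End BraidGenChoice.

(* The convention is x y x^-1 y^-1, whereas [~ x, y] is x^-1 y^-1 x y. *)
Definition comm (M : starMonoidType) (x y : M) : M := x * y * x^-1 * y^-1.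

Section BraidRelations.
Variable b : nat.

Local Notation W := (word (braid_gen b)).

Definition rho1 (j : 'I_b) : W := letter (Rho1 j).
Definition tau1 (j : 'I_b) : W := letter (Tau1 j).
Definition rho2 (j : 'I_b) : W := letter (Rho2 j).
Definition tau2 (j : 'I_b) : W := letter (Tau2 j).
Definition wA12 : W := letter A12.
Local Notation A := wA12.

(* The Goncalves-Guaschi presentation of P_2(Sigma_b); braid_rel u v is the relation u = v.
   Products are taken in increasing order of the index, so F (rev_ord j)
   yields a product from j = b down to j = 1. *)
Inductive braid_rel : W -> W -> Prop :=
| surface1 : braid_rel
    ((\prod_(i < b) (let j := rev_ord i in
        comm (rho1 j)^-1 (tau1 j)^-1 * (tau1 j)^-1))
     * \prod_(j < b) tau1 j)
    A
| surface2 : braid_rel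
    ((\prod_(j < b) (comm (rho2 j)^-1 (tau2 j) * tau2 j))
     * \prod_(i < b) (tau2 (rev_ord i))^-1)
    A^-1
| rho1_rho2_lt (j k : 'I_b) : (j < k)%N ->
    braid_rel (comm (rho1 j) (rho2 k)) 1
| rho1_rho2_eq (j : 'I_b) :
    braid_rel (comm (rho1 j) (rho2 j)) 1
| rho1_rho2_gt (j k : 'I_b) : (j > k)%N ->
    braid_rel (comm (rho1 j) (rho2 k))
              (A^-1 * rho2 k * (rho2 j)^-1 * A * rho2 j * (rho2 k)^-1)
| rho1_tau2_lt (j k : 'I_b) : (j < k)%N ->
    braid_rel (comm (rho1 j) (tau2 k)) 1
| rho1_tau2_eq (j : 'I_b) :
    braid_rel (comm (rho1 j) (tau2 j)) A^-1
| rho1_tau2_gt (j k : 'I_b) : (j > k)%N ->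
    braid_rel (comm (rho1 j) (tau2 k)) (comm A^-1 (tau2 k))
| rho1_A12 (j : 'I_b) :
    braid_rel (comm (rho1 j) A) (comm (rho2 j)^-1 A)
| tau1_rho2_lt (j k : 'I_b) : (j < k)%N ->
    braid_rel (comm (tau1 j) (rho2 k)) 1
| tau1_rho2_eq (j : 'I_b) :
    braid_rel (comm (tau1 j) (rho2 j)) ((tau2 j)^-1 * A * tau2 j)
| tau1_rho2_gt (j k : 'I_b) : (j > k)%N ->
    braid_rel (comm (tau1 j) (rho2 k)) (comm (tau2 j)^-1 A)
| tau1_tau2_lt (j k : 'I_b) : (j < k)%N ->
    braid_rel (comm (tau1 j) (tau2 k)) 1
| tau1_tau2_eq (j : 'I_b) :
    braid_rel (comm (tau1 j) (tau2 j)) (comm (tau2 j)^-1 A)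
| tau1_tau2_gt (j k : 'I_b) : (j > k)%N ->
    braid_rel (comm (tau1 j) (tau2 k))
              ((tau2 j)^-1 * A * tau2 j * A^-1 * tau2 k
               * A * (tau2 j)^-1 * A^-1 * tau2 j * (tau2 k)^-1)
| tau1_A12 (j : 'I_b) :
    braid_rel (comm (tau1 j) A) (comm (tau2 j)^-1 A).

End BraidRelations.

(* For b >= 2 this is P_2(Sigma_b), the fundamental group of the complement of
   the diagonal in Sigma_b x Sigma_b, with Sigma_b closed of genus b; braidA12
   is the class of a loop winding once around the diagonal. *)
Definition pure_braid2 (b : nat) : groupType := presented (@braid_rel b).

Definition braidA12 (b : nat) : pure_braid2 b :=
  pres_class (@braid_rel b) (@wA12 b).

Definition pure_braid_quotient_of_type (b n : nat) (G : finGroupType) : Prop :=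
  exists phi : {multiplicative pure_braid2 b -> G},
    (forall g : G, exists x : pure_braid2 b, phi x = g)
    /\ #[phi (braidA12 b)] = n.

Definition pure_braid_quotient (G : finGroupType) : Prop :=
  exists b n : nat,
    [/\ (2 <= b)%N, (2 <= n)%N & pure_braid_quotient_of_type b n G].

(* Main.v *)
Require Import Defs.
From mathcomp Require Import all_boot all_fingroup.
From mathcomp Require Import all_solvable.
From mathcomp Require Import integral_char.
From mathcomp Require Import zify.

(** Let [z] be the image of [A12] in [G]. The relations between the generators
    attached to two handles [j < k] already force the following: the subgroup
    generated by the images of these eight generators, if its order is less
    than 64, has order divisible by 32 ([handle_pair_dvd32]). Its order divides
    that of [G], and no multiple of 32 lies strictly between 32 and 64.

    Write [G] for this subgroup. The divisibility can be tested on the quotient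
    by a normal subgroup maximal among those missing [z], so every nontrivial
    normal subgroup may be assumed to contain [z]; the normal closure [M] of [z]
    is then the least one. Let [A] and [B] be generated by [M] and the
    generators of the first, respectively second, strand. They commute
    modulo [M], and conjugation by [A] and by [B] give the same orbit of [z].

    - [M] is abelian ([monolith_abelian]). Otherwise [M] is perfect of order at
      least 32, so [G = M] is simple; Burnside's theorem on class sizes then
      makes the centralizers of nontrivial elements abelian, while the braid
      relations produce a nonabelian one.

    - The counting tool ([card_separated]): for [y] in [B], the commutator with
      [y] maps ['C_A(M)] to [M], homomorphically and compatibly with [A]. When
      [A] acts irreducibly on [M], each [y] that is not centralized contributes
      a factor [#|M|] to the order of ['C_A(M)].

    - If [z] is central, the commutators are those of an extraspecial group:
      four generators of the second strand contribute, so [#|M| ^ 5] divides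
      [#|G|]. Hence [#|M| = 2], and 32 divides [#|G|] ([central_dvd32]).

    - If [z] is not central, [G] acts on [M] through an abelian group in which
      nontrivial elements have no fixed points. Three generators of the second
      strand contribute, so [#|'C_A(M)| >= #|M| ^ 3 >= 27], whereas
      ['C_A(M) < A < G] with both inclusions proper, so that
      [#|G| >= 4 * 27] ([noncentral_absurd]). *)

Set Implicit Arguments.
Unset Strict Implicit.
Unset Printing Implicit Defensive.

Local Open Scope group_scope.

(** * Simple and perfect groups of small order *)

Lemma abelian_card_le5 (gT : finGroupType) (H : {group gT}) :
  #|H| <= 5 -> abelian H.
Proof.
move=> H5; have [p1|] := boolP (prime #|H|).
  exact/cyclic_abelian/prime_cyclic.
move: H5 (cardG_gt0 H); case E: #|H| => [|[|[|[|[|[|n]]]]]] // _ _ _.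
  by rewrite (card1_trivg E) abelian1.
exact: (@card_p2group_abelian _ 2).
Qed.

(** A group with cyclic central quotient is abelian, so this quotient has
    neither prime order nor order 1; the bound and the exclusion of 5 are the
    cases that matter for a group of order less than 12. *)
Lemma nonabelian_center_index (gT : finGroupType) (H : {group gT}) :
  ~~ abelian H -> 4 <= #|H : 'Z(H)| /\ #|H : 'Z(H)| != 5.
Proof.
move=> nabH; have: ~~ cyclic (H / 'Z(H)).
  exact: contra (@cyclic_center_factor_abelian _ H) nabH.
rewrite -(card_quotient (normal_norm (center_normal H))).
have [/prime_cyclic-> //|] := boolP (prime #|H / 'Z(H)|).
have := cardG_gt0 (H / 'Z(H)).
case E: #|H / 'Z(H)| => [|[|[|[|[|[|n]]]]]] // _ _.
by rewrite (card1_trivg E) cyclic1.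
Qed.

Lemma two_primes_ge6 n : 1 < size (primes n) -> n = 6 \/ 8 <= n.
Proof. by case: n => [|[|[|[|[|[|[|[|n]]]]]]]] //; [left | right]. Qed.

(** Burnside's theorem on conjugacy classes of prime power size, together with
    the orbit formula for the class of [x]. *)
Lemma simple_class_primes (gT : finGroupType) (G : {group gT}) x :
    simple G -> ~~ abelian G -> x \in G -> x != 1 ->
  1 < size (primes #|x ^: G|) /\ #|G| = (#|'C_G[x]| * #|x ^: G|)%N.
Proof.
move=> simG nabG Gx ntx; split.
  apply: (primes_class_simple_gt1 simG nabG).
  by rewrite !inE classG_eq1 ntx mem_classes.
by rewrite -index_cent1 -(LagrangeI G 'C[x]) indexgI.
Qed.

Lemma simple_nonsolvable (gT : finGroupType) (G : {group gT}) :
  simple G -> ~~ abelian G -> ~~ solvable G.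
Proof.
move=> simG; apply: contra => solG.
exact/cyclic_abelian/prime_cyclic/simple_sol_prime.
Qed.

Lemma nonabelian_center_card_ge8 (gT : finGroupType) (H : {group gT}) :
  ~~ abelian H -> 'Z(H) != 1 -> #|H| = 8 \/ 12 <= #|H|.
Proof.
move=> /nonabelian_center_index[]; rewrite -cardG_gt1.
rewrite -(Lagrange (center_sub H)) /=; move: #|_ : _| #|_| => i m; nia.
Qed.

(** A class has at least 6 elements, so a centralizer has at most 10. Being
    nonabelian with a nontrivial centre, it would have order 8, and the class
    size would be 6: then [G] has order 48 and is solvable by the p^a q^b
    theorem. *)
Lemma simple_cent1_abelian (gT : finGroupType) (G : {group gT}) x :
    simple G -> ~~ abelian G -> #|G| < 64 -> x \in G -> x != 1 ->
  abelian 'C_G[x].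
Proof.
move=> simG nabG G64 Gx ntx; apply/negPn/negP => nabC.
have [/two_primes_ge6 c6 oG] := simple_class_primes simG nabG Gx ntx.
have ntZ : 'Z('C_G[x]) != 1.
  apply/trivgPn; exists x => //.
  by rewrite /center inE inE Gx cent1id /= -sub_cent1 subsetIr.
have C8 := nonabelian_center_card_ge8 nabC ntZ.
have G48 : #|G| = 48.
  move: G64; rewrite oG; case: C8 => [-> | C12]; first by lia.
  have c6' : 6 <= #|x ^: G| by lia.
  by rewrite ltnNge (leq_trans _ (leq_mul C12 c6')).
case/negP: (simple_nonsolvable simG nabG).
by apply: Burnside_p_a_q_b; rewrite G48.
Qed.

(** When q is the only divisor of q with two prime factors, Burnside's theorem
    determines the class size of an element of order p = 30 / q. *)
Lemma simple_class_card30 (gT : finGroupType) (G : {group gT}) p q :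
    simple G -> ~~ abelian G -> #|G| = 30 -> prime p -> 30 = (p * q)%N ->
    {in divisors q, forall c, 1 < size (primes c) -> c = q} ->
  exists x, [/\ x \in G, #[x] = p & #|x ^: G| = q].
Proof.
move=> simG nabG G30 p_pr Epq two_q.
have [|x Gx ox] := @Cauchy _ p G p_pr; first by rewrite G30 Epq dvdn_mulr.
exists x; split=> //.
have ntx : x != 1 by rewrite -order_eq1 ox neq_ltn prime_gt1 ?orbT.
have [c2 oG] := simple_class_primes simG nabG Gx ntx.
apply: two_q c2; have /dvdnP[k ock] : p %| #|'C_G[x]|.
  by rewrite -ox order_dvdG // inE Gx cent1id.
rewrite -dvdn_divisors; last by case: q Epq => //; rewrite muln0.
apply/dvdnP; exists k; apply/eqP; rewrite -(eqn_pmul2l (prime_gt0 p_pr)).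
by rewrite -Epq -G30 oG ock mulnA (mulnC p).
Qed.

Lemma class_disjoint_order (gT : finGroupType) (G : {group gT}) x y :
  #[x] != #[y] -> [disjoint x ^: G & y ^: G].
Proof.
move=> neq_o; apply/pred0P=> u /=; apply: contraNF neq_o.
case/andP=> /imsetP[g _ ->] /imsetP[h _ /(congr1 order)].
by rewrite !orderJ => ->.
Qed.

(** The classes of elements of orders 2, 3 and 5 would have 15 + 10 + 6 = 31
    elements. *)
Lemma simple_card30 (gT : finGroupType) (G : {group gT}) :
  simple G -> ~~ abelian G -> #|G| <> 30.
Proof.
move=> simG nabG G30.
have classP := simple_class_card30 simG nabG G30.
have [|||x [Gx ox cx]] := classP 2 15 => //.
  by move=> c; rewrite !inE => /or4P[]/eqP->.
have [|||y [Gy oy cy]] := classP 3 10 => //.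
  by move=> c; rewrite !inE => /or4P[]/eqP->.
have [|||u [Gu ou cu]] := classP 5 6 => //.
  by move=> c; rewrite !inE => /or4P[]/eqP->.
suff : 31 <= #|G| by rewrite G30.
have dxy : [disjoint x ^: G & y ^: G] by rewrite class_disjoint_order // ox oy.
have dxu : [disjoint x ^: G & u ^: G] by rewrite class_disjoint_order // ox ou.
have dyu : [disjoint y ^: G & u ^: G] by rewrite class_disjoint_order // oy ou.
have <- : #|(x ^: G :|: y ^: G) :|: u ^: G| = 31.
  rewrite cardsU setIUl (disjoint_setI0 dxu) (disjoint_setI0 dyu) setU0 cards0.
  by rewrite cardsU (disjoint_setI0 dxy) cards0 cx cy cu.
by rewrite subset_leq_card // !subUset !class_subG.
Qed.

Lemma three_primes_ge30 n : n <= 31 -> 2 < size (primes n) -> n = 30.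
Proof. by do 32![case: n => [|n] //]. Qed.

(** By the p^a q^b theorem the order has three prime divisors, and 30 is the
    only such number up to 31. *)
Lemma simple_nonabelian_ge32 (gT : finGroupType) (G : {group gT}) :
  simple G -> ~~ abelian G -> 32 <= #|G|.
Proof.
move=> simG nabG; rewrite ltnNge; apply/negP=> leG.
have := simple_nonsolvable simG nabG.
have [/Burnside_p_a_q_b-> //|gt2 _] := leqP (size (primes #|G|)) 2.
exact: simple_card30 simG nabG (three_primes_ge30 leG gt2).
Qed.

(** The quotient by a maximal normal subgroup is simple, and it is nonabelian
    because the group is perfect. *)
Lemma perfect_card_ge32 (gT : finGroupType) (G : {group gT}) :
  G :!=: 1 -> G \subset G^`(1) -> 32 <= #|G|.
Proof.
move=> ntG perfG; have [N maxN] : {N : {group gT} | maxnormal N G G}.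
  exact: ex_maxnormal_ntrivg ntG.
have /andP[ltNG nNG] := maxgroupp maxN.
have simQ : simple (G / N).
  by rewrite quotient_simple // /normal (proper_sub ltNG).
apply: leq_trans (leq_quotient N G); apply: simple_nonabelian_ge32 => //.
have [ntQ _] := simpleP _ simQ; apply: contra ntQ => /derG1P abQ.
by rewrite -subG1 -abQ -quotient_der ?quotientS.
Qed.

(** * Two subgroups commuting modulo an abelian normal subgroup *)

Section CommutingModulo.

Variables (gT : finGroupType) (A B M : {group gT}).
Hypotheses (abM : abelian M) (cAB : [~: A, B] \subset M).
Hypotheses (nMA : A \subset 'N(M)) (nMB : B \subset 'N(M)).

Lemma conjg_abelian : {in M &, forall m x, m ^ x = m}.
Proof.
by move=> m x Mm Mx; apply/conjg_fixP/commgP; apply: (centsP abM).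
Qed.

(** [a] and [b] commute up to an element of the abelian group [M], which acts
    trivially on [M]. *)
Lemma conjg_swap m a b :
  m \in M -> a \in A -> b \in B -> m ^ (a * b) = m ^ (b * a).
Proof.
move=> Mm Aa Bb; rewrite commgC conjgM; apply: conjg_abelian.
  by rewrite memJ_norm // groupM // (subsetP nMA a Aa, subsetP nMB b Bb).
by rewrite (subsetP cAB) ?mem_commg.
Qed.

(** For [y] in [B] the map [d |-> [~ y, d]] from [C_A(M)] to [M] is compatible
    with the conjugation action of [A]: replacing [y] by [y ^ a] multiplies it
    by an element of [M], which [d] centralizes. *)
Lemma comm_conj y d a :
  y \in B -> d \in 'C_A(M) -> a \in A -> [~ y, d] ^ a = [~ y, d ^ a].
Proof.
move=> By /setIP[Ad cMd] Aa.
have cMda : d ^ a \in 'C(M) by rewrite memJ_norm // (subsetP (norms_cent nMA)).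
have Myx x : x \in A -> [~ y, x] \in M.
  by move=> Ax; rewrite (subsetP cAB) // commGC mem_commg.
rewrite conjRg -{1}(mulKVg y (y ^ a)) -commgEl commMgJ.
have -> : [~ [~ y, a], d ^ a] = 1.
  by apply/eqP/commgP/commute_sym; apply: (centP cMda); apply: Myx.
by rewrite mulg1 (@conjg_abelian [~ y, d ^ a]) ?Myx ?groupJ.
Qed.

Lemma norm_cent1_cent (L : {group gT}) y :
    L \subset 'C_A(M) -> A \subset 'N(L) -> y \in B ->
  A \subset 'N('C_L[y]).
Proof.
move=> sLD nLA By; apply/subsetP=> a Aa; rewrite inE.
apply/subsetP=> _ /imsetP[d /setIP[Ld cyd] ->].
rewrite inE memJ_norm ?(subsetP nLA) // Ld; apply/cent1P/commute_sym/commgP.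
rewrite -comm_conj ?(subsetP sLD) //.
by rewrite conjg_eq1; apply/commgP/commute_sym/cent1P.
Qed.

(** The map [d |-> [~ y, d]] is a homomorphism from [L] to [M] with kernel
    ['C_L[y]]. Its image is stable under [A], hence is all of [M] as soon as it
    is nontrivial. *)
Lemma card_cent1_step (L : {group gT}) y :
    (forall W : {group gT}, W \subset M -> A \subset 'N(W) -> W :!=: 1 ->
       M \subset W) ->
    L \subset 'C_A(M) -> A \subset 'N(L) -> y \in B ->
  ~~ (L \subset 'C[y]) -> #|L| = (#|M| * #|'C_L[y]|)%N.
Proof.
move=> irrM sLD nLA By ncL.
have [sLA cML] := subsetIP sLD.
pose W := [set [~ y, d] | d in L].
have sWM : W \subset M.
  apply/subsetP=> _ /imsetP[d Ld ->].
  by rewrite (subsetP cAB) // commGC mem_commg // (subsetP sLA).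
have gW : group_set W.
  apply/group_setP; split.
    by apply/imsetP; exists 1; rewrite ?comm1g ?commg1.
  move=> _ _ /imsetP[d Ld ->] /imsetP[e Le ->].
  apply/imsetP; exists (e * d); first exact: groupM.
  rewrite commgMJ; congr (_ * _); apply/esym/conjg_fixP/commgP/commute_sym.
  by apply: (centP (subsetP cML _ Ld)); rewrite (subsetP sWM) // imset_f.
have nWA : A \subset 'N(W).
  apply/subsetP=> a Aa; rewrite inE.
  apply/subsetP=> _ /imsetP[_ /imsetP[d Ld ->] ->].
  rewrite comm_conj ?(subsetP sLD) //.
  by rewrite imset_f // memJ_norm // (subsetP nLA).
have ntW : group gW :!=: 1.
  have [d Ld ncyd] := subsetPn ncL; apply/trivgPn; exists [~ y, d].
    by rewrite imset_f.
  by apply: contra ncyd => /commgP/commute_sym/cent1P.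
have -> : #|M| = #|W|.
  by apply/eqP; rewrite eqn_leq !subset_leq_card ?(irrM (group gW)).
have -> : #|W| = #|y ^: L|.
  rewrite -(card_imset _ (mulgI y)) /W -imset_comp.
  by congr #|pred_of_set _|; apply: eq_imset => d /=; rewrite commgEl mulKVg.
by rewrite -index_cent1 mulnC -(LagrangeI L 'C[y]) indexgI.
Qed.

(** A substitute for the linear independence of the homomorphisms
    [d |-> [~ y, d]], tested along their successive kernels. *)
Fixpoint separated (L : {group gT}) (ys : seq gT) : bool :=
  if ys is y :: ys' then ~~ (L \subset 'C[y]) && separated 'C_L[y]%G ys'
  else true.

(** Iterating the previous count along [ys] gives one factor [#|M|] for each
    element, and [K] survives in the last kernel. *)
Lemma card_separated (K L : {group gT}) ys :
    (forall W : {group gT}, W \subset M -> A \subset 'N(W) -> W :!=: 1 ->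
       M \subset W) ->
    L \subset 'C_A(M) -> A \subset 'N(L) -> {subset ys <= B} ->
    K \subset L -> {in ys, forall y, K \subset 'C[y]} -> separated L ys ->
  #|M| ^ size ys * #|K| %| #|L|.
Proof.
move=> irrM; elim: ys L => [|y ys IHys] L sLD nLA sysB sKL cKys /=.
  by rewrite mul1n cardSg.
case/andP=> ncL sep_ys; have By : y \in B by rewrite sysB ?mem_head.
rewrite (card_cent1_step irrM sLD nLA By ncL) expnS -mulnA dvdn_mul //.
apply: IHys => //.
- exact: subset_trans (subsetIl _ _) sLD.
- exact: norm_cent1_cent.
- by move=> u ys_u; rewrite sysB // inE ys_u orbT.
- by rewrite subsetI sKL cKys ?mem_head.
by move=> u ys_u; rewrite cKys // inE ys_u orbT.
Qed.

End CommutingModulo.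

(** * The orbit of z *)

Section Orbit.

Variables (gT : finGroupType) (A B M : {group gT}) (z : gT).
Hypotheses (abM : abelian M) (cAB : [~: A, B] \subset M).
Hypotheses (nMA : A \subset 'N(M)) (nMB : B \subset 'N(M)) (Mz : z \in M).

(** If [z ^ b = z ^ a] and [z ^ c = z ^ d] then [z ^ (b * c) = z ^ (d * a)],
    because [A] and [B] commute in their action on [M]. *)
Lemma class_sub_gen (Y : {set gT}) :
    <<Y>> \subset B -> {in Y, forall y, z ^ y \in z ^: A} ->
  z ^: <<Y>> \subset z ^: A.
Proof.
move=> sYB zY; pose K := [set b in B | z ^ b \in z ^: A].
have gK : group_set K.
  apply/group_setP; split; first by rewrite inE group1 conjg1 class_refl.
  move=> b c; rewrite !inE => /andP[Bb /imsetP[a Aa zb]].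
  move=> /andP[Bc /imsetP[d Ad zc]]; rewrite groupM // conjgM zb -conjgM.
  by rewrite (conjg_swap abM cAB nMA nMB) // conjgM zc -conjgM memJ_class ?groupM.
have sYK : <<Y>> \subset group gK.
  rewrite gen_subG; apply/subsetP=> y Yy.
  by rewrite inE zY // (subsetP sYB) ?mem_gen.
apply/subsetP=> _ /imsetP[y /(subsetP sYK) Ky ->].
by move: Ky; rewrite inE => /andP[].
Qed.

(** An element of [A] that fixes [z] also fixes its conjugates under [B], since
    the actions of [A] and [B] on [M] commute. So if these conjugates generate
    [M], then the image of [A] in the automorphism group of [M] acts
    regularly on the orbit of [z]. *)
Lemma cent1_generator :
  M \subset <<z ^: B>> -> 'C_A[z] = 'C_A(M).
Proof.
move=> genM; apply/eqP; rewrite eqEsubset andbC.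
have -> /= : 'C_A(M) \subset 'C_A[z].
  by rewrite setIS // -cent_set1 centS ?sub1set.
apply/subsetP=> s /setIP[As czs]; rewrite inE As -sub_cent1.
apply: subset_trans genM _; rewrite gen_subG.
apply/subsetP=> _ /imsetP[b Bb ->]; apply/cent1P/commgP/conjg_fixP.
rewrite -conjgM -(conjg_swap abM cAB nMA nMB) // conjgM; congr (_ ^ b).
by apply/conjg_fixP/commgP; rewrite -/(commute z s); apply/cent1P; rewrite cent1C.
Qed.

Lemma card_quotient_orbit (G : {group gT}) :
    M \subset <<z ^: B>> -> A \subset G -> G \subset 'N(M) ->
  #|A / 'C_G(M)| = #|z ^: A|.
Proof.
move=> genM sAG nMG; rewrite -index_cent1 cent1_generator // card_quotient.
  by rewrite -(indexgI _ 'C_G(M)) setIA (setIidPl sAG).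
by rewrite (subset_trans sAG) // normsI ?normG // norms_cent.
Qed.

Lemma orbit_full (G : {group gT}) :
  B * A = G -> z ^: B \subset z ^: A -> z ^: A = z ^: G.
Proof.
move=> defG sBA; apply/eqP; rewrite eqEsubset classS -?defG ?mulG_subr //=.
apply/subsetP=> _ /imsetP[_ /mulsgP[b a Bb Aa ->] ->]; rewrite conjgM.
have /imsetP[d Ad ->] := subsetP sBA _ (memJ_class z Bb).
by rewrite -conjgM memJ_class ?groupM.
Qed.

End Orbit.

(** * A least normal subgroup that is abelian but not central *)

Section Monolith.

Variables (gT : finGroupType) (A B M G : {group gT}) (z : gT).
Hypotheses (abM : abelian M) (cAB : [~: A, B] \subset M).
Hypothesis sMA : M \subset A.
Hypotheses (defG : A * B = G) (defM : <<z ^: G>> = M).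
Hypotheses (zA : z ^: A = z ^: G) (zB : z ^: B = z ^: G).
Hypotheses (G64 : #|G| < 64) (ncz : ~~ (G \subset 'C[z])).
Hypothesis mono : forall N : {group gT}, N <| G -> N :!=: 1 -> z \in N.

Let sAG : A \subset G. Proof. by rewrite -defG mulG_subl. Qed.
Let sBG : B \subset G. Proof. by rewrite -defG mulG_subr. Qed.
Let nMG : G \subset 'N(M). Proof. by rewrite -defM norms_gen // class_norm. Qed.
Let nMA : A \subset 'N(M). Proof. exact: subset_trans nMG. Qed.
Let nMB : B \subset 'N(M). Proof. exact: subset_trans nMG. Qed.
Let sMG : M \subset G. Proof. exact: subset_trans sAG. Qed.
Let Mz : z \in M. Proof. by rewrite -defM mem_gen ?class_refl. Qed.
Let cBA : [~: B, A] \subset M. Proof. by rewrite commGC. Qed.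

Lemma cent1A : 'C_A[z] = 'C_A(M).
Proof. by apply: (cent1_generator abM cAB nMA nMB); rewrite ?zB ?defM. Qed.

Lemma card_quotA : #|A / 'C_G(M)| = #|z ^: G|.
Proof.
by rewrite -zA (card_quotient_orbit abM cAB nMA nMB Mz) ?zB ?defM.
Qed.

Lemma card_quotB : #|B / 'C_G(M)| = #|z ^: G|.
Proof.
by rewrite -zB (card_quotient_orbit abM cBA nMB nMA Mz) ?zA ?defM.
Qed.

Lemma orbit_ltM : #|z ^: G| < #|M|.
Proof.
have ntz : z != 1.
  by apply: contraNneq ncz => ->; rewrite cent11T subsetT.
apply: proper_card; apply/properP; split; last exists 1 => //.
  by rewrite -defM sub_gen.
by apply: contra ntz => /imsetP[g _] /esym/eqP; rewrite conjg_eq1.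
Qed.

(** In the automorphism group of [M] the images of [A] and [B] commute, and both
    act regularly on the orbit of [z]. If [A = G], then the image of [B] has
    the order of the image of [G], so it is equal to it and commutes with
    itself. Otherwise
    [#|G| >= 2 * #|A| >= 2 * #|z ^: G| * #|M| > 2 * #|z ^: G| ^ 2]
    bounds the orbit by 5, and the images of [A] and [B] have at most 5
    elements. *)
Lemma quotient_abelian : abelian (G / 'C_G(M)).
Proof.
set Q := 'C_G(M).
have nQG : G \subset 'N(Q) by rewrite normsI ?normG // norms_cent.
have cMQ : M \subset Q by rewrite subsetI sMG.
have cQ : [~: A, B] \subset Q := subset_trans cAB cMQ.
have nQA := subset_trans sAG nQG; have nQB := subset_trans sBG nQG.
have cABQ : A / Q \subset 'C(B / Q) by rewrite quotient_cents2.
have defQ : (A / Q) * (B / Q) = G / Q by rewrite -quotientMl ?defG.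
have [eqAG | neqAG] := eqVneq A G.
  have sBA : B \subset A by rewrite eqAG.
  have cBB : abelian (B / Q).
    by rewrite /abelian (subset_trans _ cABQ) ?quotientS.
  have eqB : B / Q = G / Q.
    apply/eqP; rewrite eqEcard quotientS //= card_quotB -card_quotA.
    by rewrite eqAG.
  by rewrite -eqB.
have c5 : #|z ^: G| <= 5.
  have i2 : 1 < #|G : A|.
    rewrite indexg_gt1; apply: contra neqAG => sGA.
    by rewrite -val_eqE eqEsubset sAG.
  have oA : #|A| = (#|'C_A(M)| * #|z ^: G|)%N.
    by rewrite -zA -index_cent1 cent1A Lagrange ?subsetIl.
  have leMC : #|M| <= #|'C_A(M)| by rewrite subset_leq_card // subsetI sMA.
  rewrite leqNgt; apply/negP=> i6.
  have C7 : 7 <= #|'C_A(M)| := leq_trans (leq_ltn_trans i6 orbit_ltM) leMC.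
  have : 7 * 6 * 2 <= #|G| by rewrite -(Lagrange sAG) oA !leq_mul.
  by rewrite leqNgt (ltn_trans G64).
have cAA : abelian (A / Q) by apply: abelian_card_le5; rewrite card_quotA.
have cBB : abelian (B / Q) by apply: abelian_card_le5; rewrite card_quotB.
by rewrite -defQ abelianM cAA cBB centsC.
Qed.

Lemma derived_cent : [~: G, G] \subset 'C(M).
Proof.
have nQG : G \subset 'N('C_G(M)) by rewrite normsI ?normG // norms_cent.
have : [~: G, G] \subset 'C_G(M).
  by rewrite -quotient_cents2 //; apply: quotient_abelian.
by rewrite subsetI => /andP[].
Qed.

Lemma conjg_swapG m g h :
  m \in M -> g \in G -> h \in G -> m ^ (g * h) = m ^ (h * g).
Proof.
move=> Mm Gg Gh; rewrite commgC conjgM.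
have Mx : m ^ (h * g) \in M by rewrite memJ_norm // (subsetP nMG) // groupM.
have cMgh : [~ g, h] \in 'C(M) by rewrite (subsetP derived_cent) ?mem_commg.
by apply/conjg_fixP/commgP/commute_sym; apply: (centP cMgh).
Qed.

(** As [G] acts on [M] through an abelian group, the stabilizer of [z] in [G]
    acts trivially; so [G] and [A] induce the same automorphisms of [M]. *)
Lemma irreducible_A (W : {group gT}) :
  W \subset M -> A \subset 'N(W) -> W :!=: 1 -> M \subset W.
Proof.
move=> sWM nWA ntW.
have nWG : G \subset 'N(W).
  apply/subsetP=> g Gg.
  have : z ^ g \in z ^: A by rewrite zA memJ_class.
  case/imsetP=> a Aa zga; have Ga := subsetP sAG a Aa.
  have fixz : z ^ (g * a^-1) = z by rewrite conjgM zga conjgK.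
  rewrite -[g](mulgKV a); apply: groupM; last exact: (subsetP nWA).
  apply: (subsetP (cent_sub _)); apply: (subsetP (centS sWM)).
  have Gk : g * a^-1 \in G by rewrite groupM ?groupV.
  rewrite -sub_cent1 -defM gen_subG.
  apply/subsetP=> _ /imsetP[h Gh ->]; apply/cent1P/commgP/conjg_fixP.
  by rewrite -conjgM conjg_swapG // conjgM fixz.
have zW : z \in W by apply: mono ntW; rewrite /normal (subset_trans sWM).
by rewrite -defM gen_subG class_sub_norm.
Qed.

(** Since [G] acts on [M] through an abelian group, the fixed points of [s] in
    [M] form a normal subgroup of [G]; it would contain [z]. *)
Lemma fixed_point_free s m :
  s \in A -> s \notin 'C(M) -> m \in M -> m != 1 -> ~ commute s m.
Proof.
move=> As ncs Mm ntm csm; case/negP: ncs.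
have Gs := subsetP sAG s As.
have nWG : G \subset 'N('C_M[s]).
  apply/subsetP=> g Gg; rewrite inE.
  apply/subsetP=> _ /imsetP[x /setIP[Mx /cent1P-csx] ->].
  rewrite inE memJ_norm ?(subsetP nMG) // Mx.
  apply/cent1P/commgP/conjg_fixP.
  rewrite -conjgM conjg_swapG // conjgM; congr (_ ^ g).
  by apply/conjg_fixP/commgP/commute_sym.
have zW : z \in 'C_M[s].
  apply: (mono (N := 'C_M[s]%G)).
    by rewrite /normal nWG (subset_trans (subsetIl _ _)).
  by apply/trivgPn; exists m; rewrite // inE Mm; apply/cent1P.
have : s \in 'C_A(M).
  by rewrite -cent1A inE As cent1C; case/setIP: zW.
by case/setIP.
Qed.

(** If [[~ x, s]] commuted with [y], then so would the conjugate of [s] by [x],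
    and [s] would fix the nontrivial element [[~ y, x^-1]] of [M]. *)
Lemma commutator_separates x s y :
    x \in A -> s \in A -> y \in B -> s \notin 'C(M) ->
    commute s y -> ~ commute x y ->
  [~ x, s] \in 'C_A(M) /\ ~ commute [~ x, s] y.
Proof.
move=> Ax As By ncs csy ncxy; split.
  rewrite inE groupR // (subsetP derived_cent) //.
  by rewrite mem_commg ?(subsetP sAG).
move=> cxsy; have Mm : [~ y, x^-1] \in M.
  by rewrite (subsetP cBA) // mem_commg ?groupV.
apply: (fixed_point_free As ncs Mm).
  apply: contra_notN ncxy => /commgP/commuteV.
  by rewrite invgK; apply: commute_sym.
have csx : commute (s ^ x) y.
  have -> : s ^ x = ([~ x, s] * s^-1)^-1.
    by rewrite commgEr mulgK conjVg invgK.
  apply/commute_sym/commuteV/commuteM; apply: commute_sym => //.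
  exact/commute_sym/commuteV/commute_sym.
have -> : [~ y, x^-1] = y^-1 * (y ^ x^-1) by rewrite commgEl.
apply: commuteM; first exact: commuteV.
by rewrite /commute -{1 2}(conjgK x s) -!conjMg csx.
Qed.

(** If [A = G], choose [y] in [B] moving [z]. The centralizer of [y] in
    ['C_A(M)] is normal in [G] and misses [z], so it is trivial and
    [d |-> [~ y, d]] embeds ['C_A(M)] into [M]. *)
Lemma proper_A : #|M| < #|'C_A(M)| -> ~~ (G \subset A).
Proof.
move=> ltMD; apply/negP=> sGA.
have /subsetPn[y By ncy] : ~~ (B \subset 'C[z]).
  apply: contra ncz => cBz; apply/subsetP=> g Gg; apply/cent1P.
  apply/commute_sym/commgP/conjg_fixP; have : z ^ g \in z ^: B.
    by rewrite zB memJ_class.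
  case/imsetP=> b Bb ->; apply/conjg_fixP/commgP/commute_sym/cent1P.
  exact: (subsetP cBz).
have nDA : A \subset 'N('C_A(M)) by rewrite normsI ?normG // norms_cent.
have zD : z \in 'C_A(M).
  by rewrite inE (subsetP sMA) // (subsetP abM).
have ncD : ~~ ('C_A(M) \subset 'C[y]).
  by apply/subsetPn; exists z => //; rewrite cent1C.
have oD := card_cent1_step abM cAB nMA irreducible_A (subxx _) nDA By ncD.
have nNA := norm_cent1_cent abM cAB nMA (subxx _) nDA By.
move: ltMD; rewrite oD; suff -> : 'C_('C_A(M))[y] = 1.
  by rewrite cards1 muln1 ltnn.
apply: contraNeq ncy => ntN; rewrite cent1C.
suff : z \in 'C_('C_A(M))[y] by case/setIP.
apply: (mono (N := 'C_('C_A(M))[y]%G)) => //.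
by rewrite /normal (subset_trans sGA) // subIset // subIset // sAG.
Qed.

(** Otherwise [#|'C_A(M)| >= 27], because [#|M| > #|z ^: G| >= 2], and both
    inclusions ['C_A(M) < A < G] are proper. *)
Lemma card_cent_bound : ~~ (#|M| ^ 3 %| #|'C_A(M)|).
Proof.
apply/negP=> dvM3.
have Z2 : 2 <= #|z ^: G|.
  by rewrite -index_cent1 indexgI indexg_gt1.
have M3 : 3 <= #|M| := leq_ltn_trans Z2 orbit_ltM.
have leD : #|M| ^ 3 <= #|'C_A(M)| by rewrite dvdn_leq.
have D27 : 27 <= #|'C_A(M)|.
  by apply: leq_trans leD; rewrite -[27]/(3 ^ 3)%N leq_exp2r.
have ltMD : #|M| < #|'C_A(M)|.
  apply: leq_trans leD; rewrite -{1}(expn1 #|M|) ltn_exp2l //.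
  exact: leq_trans M3.
have i2 : 2 <= #|G : A| by rewrite indexg_gt1 proper_A.
have oA : #|A| = (#|'C_A(M)| * #|z ^: G|)%N.
  by rewrite -zA -index_cent1 cent1A Lagrange ?subsetIl.
have : 27 * 2 * 2 <= #|G| by rewrite -(Lagrange sAG) oA !leq_mul.
by rewrite leqNgt (ltn_trans G64).
Qed.

End Monolith.

(** * Braid relations on two handles *)

(** The braid relations between the generators attached to two handles: the
    first digit is the strand, the second one the handle. The commutators with
    no field of their own enter through [hp_commg], by which the two strands
    commute modulo the normal closure of [z]. The last four fields say that
    conjugating [z] by a generator of one strand amounts to conjugating it by
    the inverse of its companion on the other strand. *)
Record handle_pair (gT : finGroupType) (G : {group gT})
    (r11 t11 r12 t12 r21 t21 r22 t22 z : gT) : Prop := HandlePair {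
  hp_gen : <<[set r11; t11; r12; t12] :|: [set r21; t21; r22; t22]>> = G;
  hp_commg : {in [set r11; t11; r12; t12] & [set r21; t21; r22; t22],
    forall x y, [~ x, y] \in <<z ^: G>>};
  hp_r11r21 : commute r11 r21;
  hp_r12r22 : commute r12 r22;
  hp_r11r22 : commute r11 r22;
  hp_r11t22 : commute r11 t22;
  hp_t11r22 : commute t11 r22;
  hp_t11t22 : commute t11 t22;
  hp_r11t21 : comm r11 t21 = z^-1;
  hp_r12t22 : comm r12 t22 = z^-1;
  hp_t11r21 : comm t11 r21 = z ^ t21;
  hp_t12r22 : comm t12 r22 = z ^ t22;
  hp_r1z : z ^ r11^-1 = z ^ r21;
  hp_t1z : z ^ t11^-1 = z ^ t21;
  hp_r2z : z ^ r12^-1 = z ^ r22;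
  hp_t2z : z ^ t12^-1 = z ^ t22
}.

Lemma comm_eq1 (gT : finGroupType) (x y : gT) : comm x y = 1 <-> commute x y.
Proof.
split=> [/(canRL (mulgKV _))|cxy]; last by rewrite /comm cxy !mulgK mulgV.
by rewrite mul1g => /(canRL (mulgKV _)).
Qed.

Lemma commgE_comm (gT : finGroupType) (x y : gT) :
  [~ x, y] = comm x y ^ (y * x).
Proof.
by rewrite conjgE /comm commgEl conjgE invMg !mulgA !(mulgKV, mulgK).
Qed.

Section HandlePair.

Variables (gT : finGroupType) (G : {group gT}).
Variables (r11 t11 r12 t12 r21 t21 r22 t22 z : gT).
Hypothesis hp : handle_pair G r11 t11 r12 t12 r21 t21 r22 t22 z.
Hypotheses (ntz : z != 1) (G64 : #|G| < 64).

Let X := [set r11; t11; r12; t12].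
Let Y := [set r21; t21; r22; t22].

Let sXG : X \subset G. Proof. by rewrite -(hp_gen hp) sub_gen ?subsetUl. Qed.
Let sYG : Y \subset G. Proof. by rewrite -(hp_gen hp) sub_gen ?subsetUr. Qed.

Let Xr11 : r11 \in X. Proof. by rewrite !inE eqxx ?orbT. Qed.
Let Xt11 : t11 \in X. Proof. by rewrite !inE eqxx ?orbT. Qed.
Let Xr12 : r12 \in X. Proof. by rewrite !inE eqxx ?orbT. Qed.
Let Xt12 : t12 \in X. Proof. by rewrite !inE eqxx ?orbT. Qed.
Let Yr21 : r21 \in Y. Proof. by rewrite !inE eqxx ?orbT. Qed.
Let Yt21 : t21 \in Y. Proof. by rewrite !inE eqxx ?orbT. Qed.
Let Yr22 : r22 \in Y. Proof. by rewrite !inE eqxx ?orbT. Qed.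
Let Yt22 : t22 \in Y. Proof. by rewrite !inE eqxx ?orbT. Qed.

Lemma handle_pair_mem : z \in G.
Proof.
have [Gr11 Gt21] := (subsetP sXG _ Xr11, subsetP sYG _ Yt21).
by rewrite -groupV -(hp_r11t21 hp) /comm !groupM ?groupV.
Qed.

Let Gz := handle_pair_mem.

Lemma nc_r11t21 : ~ commute r11 t21.
Proof.
by move/comm_eq1; rewrite (hp_r11t21 hp) => /eqP; rewrite invg_eq1 (negPf ntz).
Qed.

Lemma nc_r12t22 : ~ commute r12 t22.
Proof.
by move/comm_eq1; rewrite (hp_r12t22 hp) => /eqP; rewrite invg_eq1 (negPf ntz).
Qed.

Lemma nc_t11r21 : ~ commute t11 r21.
Proof.
by move/comm_eq1; rewrite (hp_t11r21 hp) => /eqP; rewrite conjg_eq1 (negPf ntz).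
Qed.

Lemma nc_t12r22 : ~ commute t12 r22.
Proof.
by move/comm_eq1; rewrite (hp_t12r22 hp) => /eqP; rewrite conjg_eq1 (negPf ntz).
Qed.

(** Were centralizers abelian, commutation would be transitive on nontrivial
    elements; the chain [r12, r22, r11, t22] would then make [r12] and [t22]
    commute. *)
Lemma exists_nonabelian_cent1 :
  exists2 x, x \in G & x != 1 /\ ~~ abelian 'C_G[x].
Proof.
have nt_l (x y : gT) : ~ commute x y -> x != 1.
  move=> ncxy; apply: contra_notN ncxy => /eqP->.
  by apply: commute_sym; apply: commute1.
have nt_r (x y : gT) : ~ commute x y -> y != 1.
  by move=> ncxy; apply: contra_notN ncxy => /eqP->; apply: commute1.
have [Gr11 Gr12] := (subsetP sXG _ Xr11, subsetP sXG _ Xr12).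
have [Gr22 Gt22] := (subsetP sYG _ Yr22, subsetP sYG _ Yt22).
have [ab11|] := boolP (abelian 'C_G[r11]); last first.
  by exists r11 => //; split=> //; apply: nt_l nc_r11t21.
exists r22 => //; split; first exact: nt_r nc_t12r22.
apply/negP=> ab22; apply: nc_r12t22; apply: (centsP ab22).
  by rewrite inE Gr12; apply/cent1P/(hp_r12r22 hp).
rewrite inE Gt22; apply/cent1P; apply: (centsP ab11).
  by rewrite inE Gt22; apply/cent1P/commute_sym/(hp_r11t22 hp).
by rewrite inE Gr22; apply/cent1P/commute_sym/(hp_r11r22 hp).
Qed.

Hypothesis mono : forall N : {group gT}, N <| G -> N :!=: 1 -> z \in N.

Let M := <<z ^: G>>%G.

Let nMG : M <| G.
Proof.
by rewrite /normal gen_subG class_subG // norms_gen // class_norm.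
Qed.

Let minM (N : {group gT}) : N <| G -> N :!=: 1 -> M \subset N.
Proof.
by move=> nNG ntN; rewrite gen_subG class_sub_norm ?mono // normal_norm.
Qed.

Let Mz : z \in M. Proof. by rewrite mem_gen ?class_refl. Qed.

Let ntM : M :!=: 1. Proof. by apply/trivgPn; exists z. Qed.

(** If [M] is nonabelian then it is perfect, since its derived subgroup contains
    [z]. So [#|M| >= 32], hence [M = G] and [G] is simple, which contradicts
    the existence of a nonabelian centralizer. *)
Lemma monolith_abelian : abelian M.
Proof.
apply/negPn/negP=> nabM.
have perfM : M \subset M^`(1).
  apply: (minM (N := M^`(1)%G)); last by rewrite (sameP eqP derG1P).
  exact: char_normal_trans (der_char 1 M) nMG.
have M32 := perfect_card_ge32 ntM perfM.
have sGM : G \subset M.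
  rewrite -indexg_eq1 eqn_leq indexg_gt0 andbT leqNgt; apply/negP=> i2.
  have : 32 * 2 <= #|G| by rewrite -(Lagrange (normal_sub nMG)) leq_mul.
  by rewrite leqNgt G64.
have simG : simple G.
  apply/simpleP; split; first by apply/trivgPn; exists z.
  move=> N nNG; have [-> | ntN] := eqVneq (N : {set gT}) 1; [by left | right].
  apply/eqP; rewrite eqEsubset normal_sub //.
  exact: subset_trans sGM (minM nNG ntN).
have nabG : ~~ abelian G.
  by apply: contra nabM; apply: abelianS; apply: normal_sub.
have [x Gx [ntx /negP[]]] := exists_nonabelian_cent1.
exact: simple_cent1_abelian.
Qed.

Let A := (<<X>> <*> M)%G.
Let B := (<<Y>> <*> M)%G.

Let sMA : M \subset A. Proof. exact: joing_subr. Qed.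
Let sMB : M \subset B. Proof. exact: joing_subr. Qed.
Let sXA : X \subset A. Proof. by rewrite -gen_subG joing_subl. Qed.
Let sYB : Y \subset B. Proof. by rewrite -gen_subG joing_subl. Qed.
Let sAG : A \subset G. Proof. by rewrite join_subG gen_subG sXG normal_sub. Qed.
Let sBG : B \subset G. Proof. by rewrite join_subG gen_subG sYG normal_sub. Qed.
Let nMA : A \subset 'N(M). Proof. exact: subset_trans (normal_norm nMG). Qed.
Let nMB : B \subset 'N(M). Proof. exact: subset_trans (normal_norm nMG). Qed.

Lemma commutator_AB : [~: A, B] \subset M.
Proof.
rewrite -quotient_cents2 //.
have nMX : X \subset 'N(M) := subset_trans sXA nMA.
have nMY : Y \subset 'N(M) := subset_trans sYB nMB.
rewrite /= !quotientYidr ?gen_subG // !quotient_gen // cent_gen gen_subG.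
apply/subsetP=> _ /morphimP[x Nx Xx ->]; apply/centP=> _ /morphimP[y Ny Yy ->].
apply/commgP; rewrite -morphR //; apply/eqP; apply: coset_id.
exact: (hp_commg hp).
Qed.

Lemma mulAB : A * B = G.
Proof.
rewrite -norm_joinEr; last first.
  by rewrite -commg_subl (subset_trans commutator_AB).
apply/eqP; rewrite eqEsubset join_subG sAG sBG /=.
suff : <<X :|: Y>> \subset A <*> B by rewrite (hp_gen hp).
rewrite gen_subG subUset (subset_trans sXA (joing_subl A B)).
exact: subset_trans sYB (joing_subr A B).
Qed.

Lemma mulBA : B * A = G.
Proof.
rewrite -mulAB (normC (A := A)) // -commg_subr.
exact: subset_trans commutator_AB _.
Qed.

Let abM := monolith_abelian.

Let cBA : [~: B, A] \subset M. Proof. by rewrite commGC commutator_AB. Qed.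

(** The relations exchange conjugation of [z] by a generator of [B] with
    conjugation by the inverse of a generator of [A]. *)
Lemma orbit_A : z ^: A = z ^: G.
Proof.
apply: orbit_full mulBA _.
have defB : <<Y :|: M>> = B by rewrite /= joing_idl.
rewrite -{1}defB.
apply: (class_sub_gen abM commutator_AB nMA nMB Mz); first by rewrite defB.
move=> y /setUP[]; last first.
  by move=> My; rewrite (conjg_abelian abM) // class_refl.
have AxV : {in X, forall x, x^-1 \in A}.
  by move=> x Xx; rewrite groupV (subsetP sXA).
rewrite !inE -!orbA => /or4P[]/eqP->.
- by rewrite -(hp_r1z hp) memJ_class ?AxV.
- by rewrite -(hp_t1z hp) memJ_class ?AxV.
- by rewrite -(hp_r2z hp) memJ_class ?AxV.
by rewrite -(hp_t2z hp) memJ_class ?AxV.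
Qed.

Lemma orbit_B : z ^: B = z ^: G.
Proof.
apply: orbit_full mulAB _.
have defA : <<X^-1 :|: M>> = A by rewrite -[LHS]joing_idl genV.
rewrite -{1}defA.
apply: (class_sub_gen abM cBA nMB nMA Mz); first by rewrite defA.
move=> x /setUP[]; last first.
  by move=> Mx; rewrite (conjg_abelian abM) // class_refl.
have BY : {in Y, forall y, y \in B} by apply/subsetP.
rewrite -(invgK x) memV_invg; move: x^-1 => x'.
rewrite !inE -!orbA => /or4P[]/eqP->.
- by rewrite (hp_r1z hp) memJ_class ?BY.
- by rewrite (hp_t1z hp) memJ_class ?BY.
- by rewrite (hp_r2z hp) memJ_class ?BY.
by rewrite (hp_t2z hp) memJ_class ?BY.
Qed.

Let XA : {in X, forall x, x \in A}. Proof. exact/subsetP. Qed.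
Let YB : {in Y, forall y, y \in B}. Proof. exact/subsetP. Qed.

Let notcent (L : {group gT}) w y :
  w \in L -> ~ commute w y -> ~~ (L \subset 'C[y]).
Proof.
by move=> Lw ncwy; apply/subsetPn; exists w => //; apply/cent1P.
Qed.

Let in_cent1 (L : {group gT}) w y :
  w \in L -> commute w y -> w \in 'C_L[y].
Proof. by move=> Lw cwy; rewrite inE Lw; apply/cent1P. Qed.

(** Here [M] is central and [A = 'C_A(M)]. The elements [r22, t22, r21, t21] are
    separated by [t12, r12, t11, r11], which gives a factor [#|M| ^ 4] besides
    [M] itself; and [#|M| >= 3] would give [3 ^ 5 > 63]. *)
Lemma central_dvd32 : G \subset 'C[z] -> 32 %| #|G|.
Proof.
move=> cGz.
have cMG : M \subset 'C(G).
  by rewrite gen_subG class_sub_norm ?norms_cent ?normG // -sub_cent1.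
have irrM (W : {group gT}) :
    W \subset M -> A \subset 'N(W) -> W :!=: 1 -> M \subset W.
  move=> sWM _; apply: minM; apply/andP; split.
    exact: subset_trans sWM (normal_sub nMG).
  by apply: cents_norm; rewrite centsC (subset_trans sWM).
have sAD : A \subset 'C_A(M).
  by rewrite subsetI subxx (subset_trans sAG) // centsC.
have ysB : {subset [:: r22; t22; r21; t21] <= B}.
  by move=> y; rewrite !inE => /or4P[]/eqP->; apply: YB.
have cMys : {in [:: r22; t22; r21; t21], forall y, M \subset 'C[y]}.
  move=> y /ysB/(subsetP sBG) Gy.
  by rewrite (subset_trans cMG) // -cent_set1 centS // sub1set.
have sep : separated A [:: r22; t22; r21; t21].
  rewrite /= andbT; apply/and4P; split.
  - exact: notcent (XA Xt12) nc_t12r22.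
  - exact: notcent (in_cent1 (XA Xr12) (hp_r12r22 hp)) nc_r12t22.
  - apply: notcent nc_t11r21.
    exact: in_cent1 (in_cent1 (XA Xt11) (hp_t11r22 hp)) (hp_t11t22 hp).
  apply: notcent nc_r11t21; apply: in_cent1 (hp_r11r21 hp).
  exact: in_cent1 (in_cent1 (XA Xr11) (hp_r11r22 hp)) (hp_r11t22 hp).
have := card_separated abM commutator_AB nMA irrM sAD (normG A) ysB sMA cMys sep.
rewrite -expnSr => /dvdn_trans/(_ (cardSg sAG)) dvG.
have : 2 <= #|M| by rewrite cardG_gt1.
rewrite leq_eqVlt => /predU1P[oM | M3]; first by rewrite -oM in dvG.
have : 64 <= #|G|.
  apply: leq_trans (dvdn_leq _ dvG) => //.
  by apply: (@leq_trans (3 ^ 5)); rewrite // leq_exp2r.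
by rewrite leqNgt G64.
Qed.

(** Three generators of the second strand are separated by elements of
    ['C_A(M)], which contradicts [card_cent_bound]. If [s], one of [r11] and
    [t11], acts nontrivially on [M], then [[~ t12, s]] and [[~ r12, s]] separate
    [r22] and [t22]. As [r11] and [t11] commute with [r22] and [t22], the third
    element is [r21], separated by [[~ t11, r11]], or, if [r11] acts trivially,
    [t21], separated by [r11]. If [r11] and [t11] both act trivially on [M],
    they separate [t21] and [r21], and [z] itself separates one of [r22] and
    [t22]. *)
Lemma noncentral_absurd : ~~ (G \subset 'C[z]) -> False.
Proof.
move=> ncz.
have defM : <<z ^: G>> = M by [].
have irrM := irreducible_A abM commutator_AB sMA mulAB defM orbit_A orbit_B
  G64 ncz mono.
have sepC := commutator_separates abM commutator_AB sMA mulAB defM orbit_A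
  orbit_B G64 ncz mono.
have nDA : A \subset 'N('C_A(M)) by rewrite normsI ?normG // norms_cent.
have no_three ys :
    size ys = 3 -> {subset ys <= Y} -> separated 'C_A(M)%G ys -> False.
  move=> ys3 sysY sep.
  have sysB : {subset ys <= B} by move=> y /sysY/YB.
  have := card_separated abM commutator_AB nMA irrM (subxx _) nDA sysB (sub1G _)
    (fun y _ => sub1G _) sep.
  rewrite cards1 muln1 ys3 => dvM.
  by case/negP: (card_cent_bound abM commutator_AB sMA mulAB defM orbit_A
    orbit_B G64 ncz mono).
have commR (x s y : gT) : commute x y -> commute s y -> commute [~ x, s] y.
  move=> cxy csy; apply: commute_sym; apply: commuteM.
    exact/commuteV/commute_sym.
  apply: commuteM; first exact/commuteV/commute_sym.
  by apply: commuteM; apply: commute_sym.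
have sepA s : s \in X -> s \notin 'C(M) -> commute s r22 -> commute s t22 ->
    ~~ ('C_A(M) \subset 'C[r22]) && ~~ ('C_('C_A(M))[r22] \subset 'C[t22]).
  move=> Xs ncs csr cst; apply/andP; split.
    have [] := sepC _ _ _ (XA Xt12) (XA Xs) (YB Yr22) ncs csr nc_t12r22.
    exact: notcent.
  have [Dw ncw] := sepC _ _ _ (XA Xr12) (XA Xs) (YB Yt22) ncs cst nc_r12t22.
  apply: notcent ncw; apply: in_cent1 => //; apply: commR csr.
  exact: (hp_r12r22 hp).
have [cr | ncr] := boolP (r11 \in 'C(M)); last first.
  have /andP[sep1 sep2] := sepA _ Xr11 ncr (hp_r11r22 hp) (hp_r11t22 hp).
  apply: (no_three [:: r22; t22; r21]) => //.
    by move=> y; rewrite !inE => /or3P[]/eqP->; rewrite eqxx ?orbT.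
  rewrite /= sep1 sep2 /= andbT.
  have [Dw ncw] := sepC _ _ _ (XA Xt11) (XA Xr11) (YB Yr21) ncr
    (hp_r11r21 hp) nc_t11r21.
  apply: notcent ncw; apply: in_cent1; first apply: in_cent1 => //.
    exact: commR (hp_t11r22 hp) (hp_r11r22 hp).
  exact: commR (hp_t11t22 hp) (hp_r11t22 hp).
have Dr11 : r11 \in 'C_A(M) by rewrite inE XA.
have [ct | nct] := boolP (t11 \in 'C(M)); last first.
  have /andP[sep1 sep2] := sepA _ Xt11 nct (hp_t11r22 hp) (hp_t11t22 hp).
  apply: (no_three [:: r22; t22; t21]) => //.
    by move=> y; rewrite !inE => /or3P[]/eqP->; rewrite eqxx ?orbT.
  rewrite /= sep1 sep2 /= andbT; apply: notcent nc_r11t21.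
  exact: in_cent1 (in_cent1 Dr11 (hp_r11r22 hp)) (hp_r11t22 hp).
have Dt11 : t11 \in 'C_A(M) by rewrite inE XA.
have cz x y : z ^ x^-1 = z ^ y -> commute z y -> commute x z.
  move=> e /commgP/conjg_fixP zy; rewrite zy in e.
  by apply: commute_sym; apply/commgP/conjg_fixP; rewrite -{1}e conjgKV.
have czr21 : commute z r21.
  apply/commgP/conjg_fixP; rewrite -(hp_r1z hp); apply/conjg_fixP/commgP/commuteV.
  exact: commute_sym (centP cr z Mz).
have czt21 : commute z t21.
  apply/commgP/conjg_fixP; rewrite -(hp_t1z hp); apply/conjg_fixP/commgP/commuteV.
  exact: commute_sym (centP ct z Mz).
have Dz : z \in 'C_A(M) by rewrite inE (subsetP sMA) // (subsetP abM).
have sep12 y : y \in Y -> ~ commute z y -> separated 'C_A(M)%G [:: r21; t21; y].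
  move=> Yy nczy; rewrite /= andbT; apply/and3P; split.
  - exact: notcent nc_t11r21.
  - exact: notcent (in_cent1 Dr11 (hp_r11r21 hp)) nc_r11t21.
  exact: notcent (in_cent1 (in_cent1 Dz czr21) czt21) nczy.
have [czr22 | nc] := boolP (z \in 'C[r22]); last first.
  apply: (no_three [:: r21; t21; r22]) => //; last by apply: sep12 => //; apply/cent1P.
  by move=> y; rewrite !inE => /or3P[]/eqP->; rewrite eqxx ?orbT.
have [czt22 | nc] := boolP (z \in 'C[t22]); last first.
  apply: (no_three [:: r21; t21; t22]) => //; last by apply: sep12 => //; apply/cent1P.
  by move=> y; rewrite !inE => /or3P[]/eqP->; rewrite eqxx ?orbT.
case/negP: ncz; rewrite -{1}(hp_gen hp) gen_subG subUset.
apply/andP; split; apply/subsetP=> x Xx; apply/cent1P; move: Xx.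
  rewrite !inE -!orbA => /or4P[]/eqP->.
  - exact: (centP cr).
  - exact: (centP ct).
  - exact: cz (hp_r2z hp) (cent1P czr22).
  exact: cz (hp_t2z hp) (cent1P czt22).
rewrite !inE -!orbA => /or4P[]/eqP->; apply: commute_sym => //; exact/cent1P.
Qed.

Lemma monolith_dvd32 : 32 %| #|G|.
Proof.
by have [/central_dvd32|/noncentral_absurd] := boolP (G \subset 'C[z]).
Qed.

End HandlePair.

Lemma handle_pair_quotient (gT : finGroupType) (G N : {group gT})
    (r11 t11 r12 t12 r21 t21 r22 t22 z : gT) :
    N <| G -> handle_pair G r11 t11 r12 t12 r21 t21 r22 t22 z ->
  handle_pair (G / N)%G (coset N r11) (coset N t11) (coset N r12)
    (coset N t12) (coset N r21) (coset N t21) (coset N r22) (coset N t22)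
    (coset N z).
Proof.
move=> nNG hp; have nNN := normal_norm nNG.
set X := [set r11; t11; r12; t12]; set Y := [set r21; t21; r22; t22].
have genXY : <<X :|: Y>> = G := hp_gen hp.
have nX : X \subset 'N(N).
  by rewrite (subset_trans _ nNN) // -(hp_gen hp) sub_gen ?subsetUl.
have nY : Y \subset 'N(N).
  by rewrite (subset_trans _ nNN) // -(hp_gen hp) sub_gen ?subsetUr.
have [Nr11 Nt11 Nr12 Nt12] : 
    [/\ r11 \in 'N(N), t11 \in 'N(N), r12 \in 'N(N) & t12 \in 'N(N)].
  by split; apply: (subsetP nX); rewrite !inE eqxx ?orbT.
have [Nr21 Nt21 Nr22 Nt22] : 
    [/\ r21 \in 'N(N), t21 \in 'N(N), r22 \in 'N(N) & t22 \in 'N(N)].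
  by split; apply: (subsetP nY); rewrite !inE eqxx ?orbT.
have Nz : z \in 'N(N).
  by rewrite -groupV -(hp_r11t21 hp) /comm !groupM ?groupV.
have fX : coset N @: X =
    [set coset N r11; coset N t11; coset N r12; coset N t12].
  by rewrite !imsetU !imset_set1.
have fY : coset N @: Y =
    [set coset N r21; coset N t21; coset N r22; coset N t22].
  by rewrite !imsetU !imset_set1.
have commQ x y : x \in 'N(N) -> y \in 'N(N) -> commute x y ->
    commute (coset N x) (coset N y).
  by move=> Nx Ny cxy; rewrite /commute -!morphM // cxy.
have cosetC x y : x \in 'N(N) -> y \in 'N(N) ->
    comm (coset N x) (coset N y) = coset N (comm x y).
  by move=> Nx Ny; rewrite /comm !morphM ?morphV ?groupM ?groupV.
have conjQ x y : z ^ x^-1 = z ^ y -> x \in 'N(N) -> y \in 'N(N) ->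
    coset N z ^ (coset N x)^-1 = coset N z ^ coset N y.
  by move=> e Nx Ny; rewrite -morphV // -!morphJ ?groupV // e.
split.
- rewrite -fX -fY -imsetU -morphimEsub; last by rewrite subUset nX.
  rewrite -morphim_gen; last by rewrite subUset nX.
  by rewrite genXY.
- rewrite -fX -fY => _ _ /imsetP[x Xx ->] /imsetP[y Yy ->].
  have Nx := subsetP nX x Xx; have Ny := subsetP nY y Yy.
  have Gz := handle_pair_mem hp.
  rewrite -morphR // -[coset N z ^: _]morphim_class // -morphim_gen; last first.
    by rewrite (subset_trans _ nNN) // class_subG.
  by apply: mem_morphim; [exact: groupR | exact: (hp_commg hp)].
- exact: commQ (hp_r11r21 hp).
- exact: commQ (hp_r12r22 hp).
- exact: commQ (hp_r11r22 hp).
- exact: commQ (hp_r11t22 hp).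
- exact: commQ (hp_t11r22 hp).
- exact: commQ (hp_t11t22 hp).
- by rewrite cosetC // (hp_r11t21 hp) morphV.
- by rewrite cosetC // (hp_r12t22 hp) morphV.
- by rewrite cosetC // (hp_t11r21 hp) morphJ.
- by rewrite cosetC // (hp_t12r22 hp) morphJ.
- exact: conjQ (hp_r1z hp) _ _.
- exact: conjQ (hp_t1z hp) _ _.
- exact: conjQ (hp_r2z hp) _ _.
exact: conjQ (hp_t2z hp) _ _.
Qed.

(** The relations survive in the quotient by a normal subgroup that is maximal
    among those missing [z], and there every nontrivial normal subgroup
    contains [z]. *)
Lemma handle_pair_dvd32 (gT : finGroupType) (G : {group gT})
    (r11 t11 r12 t12 r21 t21 r22 t22 z : gT) :
    handle_pair G r11 t11 r12 t12 r21 t21 r22 t22 z -> z != 1 -> #|G| < 64 ->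
  32 %| #|G|.
Proof.
move=> hp ntz G64.
have [|N maxN _] := @maxgroup_exists _ (fun N => (N <| G) && (z \notin N)) 1.
  by rewrite normal1 inE.
have [/andP[nNG zN] maxP] := maxgroupP maxN.
have Gz := handle_pair_mem hp.
have hpQ := handle_pair_quotient nNG hp.
apply: (dvdn_trans _ (dvdn_quotient G N)).
apply: (monolith_dvd32 hpQ).
- apply: contra zN => /eqP; apply: coset_idr.
  exact: subsetP (normal_norm nNG) z Gz.
- exact: leq_ltn_trans (leq_quotient N G) G64.
move=> K nKG; have [H -> sNH nHG] := inv_quotientN nNG nKG.
have [zH _|zH ntH] := boolP (z \in H); first exact: mem_quotient.
by case/eqP: ntH; rewrite -(maxP H) ?nHG ?zH ?trivg_quotient //.
Qed.

(** * From the presentation to two handles *)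

Section Evaluation.

Variables (b : nat) (gT : finGroupType).
Variable phi : {multiplicative pure_braid2 b -> gT}.

Local Notation W := (word (braid_gen b)).

Let ev (w : W) : gT := phi (pres_class (@braid_rel b) w).

Lemma evM u v : ev (u * v) = ev u * ev v.
Proof. by rewrite /ev pres_classM gmulfM. Qed.

Lemma ev1 : ev 1 = 1.
Proof. by apply: (mulgI (ev 1)); rewrite -evM !mulg1. Qed.

Lemma ev_rel u v : braid_rel u v -> ev u = ev v.
Proof. by move=> uv; congr (phi _); apply/pres_classP/pres_rel. Qed.

Lemma evV u : ev u^-1 = (ev u)^-1.
Proof.
apply: (mulIg (ev u)); rewrite -evM mulVg -ev1; congr (phi _).
exact/pres_classP/pres_mulVg.
Qed.

Lemma ev_comm u v : ev (comm u v) = comm (ev u) (ev v).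
Proof. by rewrite /comm !evM !evV. Qed.

Let evE := (ev_comm, evM, evV, ev1).

Variables (j k : 'I_b).
Hypothesis ltjk : j < k.

(** As [j < k], the generators of handle [j] on the first strand commute with
    those of handle [k] on the second one. Modulo the normal closure of [z] all
    the commutators between the two strands vanish, since each of them is a
    product of conjugates of [z] and its inverse. *)
Lemma handle_pair_braid :
  exists G : {group gT}, handle_pair G
    (ev (rho1 j)) (ev (tau1 j)) (ev (rho1 k)) (ev (tau1 k))
    (ev (rho2 j)) (ev (tau2 j)) (ev (rho2 k)) (ev (tau2 k)) (ev (wA12 b)).
Proof.
set z := ev (wA12 b).
pose X := [set ev (rho1 j); ev (tau1 j); ev (rho1 k); ev (tau1 k)].
pose Y := [set ev (rho2 j); ev (tau2 j); ev (rho2 k); ev (tau2 k)].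
exists <<X :|: Y>>%G.
have rel u v : braid_rel u v -> ev u = ev v by apply: ev_rel.
have zV (x y : gT) : comm x z = comm y^-1 z -> z ^ x^-1 = z ^ y.
  by move/mulIg; rewrite !invgK !conjgE invgK !mulgA.
have e_rr := rel _ _ (rho1_rho2_gt ltjk); rewrite !evE -/z in e_rr.
have e_rt := rel _ _ (rho1_tau2_gt ltjk); rewrite !evE -/z in e_rt.
have e_tr := rel _ _ (tau1_rho2_gt ltjk); rewrite !evE -/z in e_tr.
have e_tt := rel _ _ (tau1_tau2_gt ltjk); rewrite !evE -/z in e_tt.
have c_rr := rel _ _ (rho1_rho2_lt ltjk); rewrite !evE in c_rr.
have c_rt := rel _ _ (rho1_tau2_lt ltjk); rewrite !evE in c_rt.
have c_tr := rel _ _ (tau1_rho2_lt ltjk); rewrite !evE in c_tr.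
have c_tt := rel _ _ (tau1_tau2_lt ltjk); rewrite !evE in c_tt.
have d_rr i : comm (ev (rho1 i)) (ev (rho2 i)) = 1.
  by have := rel _ _ (rho1_rho2_eq i); rewrite !evE.
have d_rt i : comm (ev (rho1 i)) (ev (tau2 i)) = z^-1.
  by have := rel _ _ (rho1_tau2_eq i); rewrite !evE.
have d_tr i : comm (ev (tau1 i)) (ev (rho2 i)) = z ^ ev (tau2 i).
  by rewrite conjgE mulgA; have := rel _ _ (tau1_rho2_eq i); rewrite !evE.
have d_tt i : comm (ev (tau1 i)) (ev (tau2 i)) = comm (ev (tau2 i))^-1 z.
  by have := rel _ _ (tau1_tau2_eq i); rewrite !evE.
have rz i : z ^ (ev (rho1 i))^-1 = z ^ ev (rho2 i).
  by apply: zV; have := rel _ _ (rho1_A12 i); rewrite !evE.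
have tz i : z ^ (ev (tau1 i))^-1 = z ^ ev (tau2 i).
  by apply: zV; have := rel _ _ (tau1_A12 i); rewrite !evE.
split=> //; try exact/comm_eq1.
have GX : {subset X <= <<X :|: Y>>} by apply/subsetP; rewrite sub_gen ?subsetUl.
have GY : {subset Y <= <<X :|: Y>>} by apply/subsetP; rewrite sub_gen ?subsetUr.
set M := <<z ^: _>>.
have Mz : z \in M by rewrite mem_gen ?class_refl.
have nM g : g \in <<X :|: Y>> -> forall m, (m ^ g \in M) = (m \in M).
  move=> Gg m; apply: memJ_norm; apply: subsetP Gg.
  by rewrite norms_gen ?class_norm.
move=> x y Xx Yy; rewrite commgE_comm nM; last first.
  by apply: groupM; [apply: GY | apply: GX].
move: Yy; rewrite !inE -!orbA.
have Y1 : ev (rho2 j) \in <<X :|: Y>> by rewrite GY // !inE eqxx ?orbT.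
have Y2 : ev (tau2 j) \in <<X :|: Y>> by rewrite GY // !inE eqxx ?orbT.
have Y3 : ev (rho2 k) \in <<X :|: Y>> by rewrite GY // !inE eqxx ?orbT.
have Y4 : ev (tau2 k) \in <<X :|: Y>> by rewrite GY // !inE eqxx ?orbT.
have Mzg g : g \in <<X :|: Y>> -> z ^ g \in M by move=> Gg; rewrite nM.
have Mc g : g \in <<X :|: Y>> -> comm g^-1 z \in M.
  move=> Gg; have -> : comm g^-1 z = z ^ g * z^-1.
    by rewrite /comm conjgE invgK mulgA.
  by rewrite groupM ?groupV ?Mzg.
move: Xx; rewrite !inE -!orbA => /or4P[]/eqP-> /or4P[]/eqP->;
  rewrite ?(d_rr, d_rt, d_tr, d_tt, c_rr, c_rt, c_tr, c_tt) ?groupV ?Mzg ?Mc //.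
- rewrite e_rr.
  have -> : z^-1 * ev (rho2 j) * (ev (rho2 k))^-1 * z * ev (rho2 k)
      * (ev (rho2 j))^-1
    = z^-1 * z ^ (ev (rho2 k) * (ev (rho2 j))^-1).
    by rewrite conjgE invMg invgK !mulgA.
  by rewrite groupM ?groupV // Mzg // groupM ?groupV.
- rewrite e_rt.
  have -> : comm z^-1 (ev (tau2 j)) = z^-1 * z ^ (ev (tau2 j))^-1.
    by rewrite /comm conjgE !invgK !mulgA.
  by rewrite groupM ?groupV // Mzg // groupV.
- by rewrite e_tr Mc.
rewrite e_tt; set u := ev (tau2 k); set v := ev (tau2 j).
have -> : u^-1 * z * u * z^-1 * v * z * u^-1 * z^-1 * u * v^-1
    = z ^ u * z^-1 * (z * (z ^ u)^-1) ^ v^-1.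
  by rewrite !conjgE !invMg !invgK !mulgA.
apply: groupM; first by rewrite groupM ?groupV ?Mzg.
by rewrite nM ?groupV // groupM ?groupV ?Mzg.
Qed.

End Evaluation.

Theorem theorem9 (G : finGroupType) :
  (32 < #|G| < 64)%N -> ~ pure_braid_quotient G.
Proof.
case/andP=> G32 G64 [b [n [b2 n2 [phi [_ oz]]]]].
have lt01 : Ordinal (ltnW b2) < Ordinal b2 by [].
have [H hpH] := handle_pair_braid phi lt01.
have ntz : phi (braidA12 b) != 1 by rewrite -order_eq1 oz neq_ltn n2 orbT.
have H64 : #|H| < 64 by apply: leq_ltn_trans G64; apply: max_card.
have dvH := handle_pair_dvd32 hpH ntz H64.
have : 32 %| #|G| by apply: dvdn_trans dvH _; rewrite -cardsT cardSg ?subsetT.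
by case/dvdnP=> q oG; move: G32 G64; rewrite oG; case: q {oG} => [|[|q]].
Qed.
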